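(* Let $p$ be the mesh pattern $(12,R)$ with $R=\{(0,1),(0,2),(1,0),(2,0)\}$, let $E(t,u)=\sum_{n\ge0}t^n\sum_{\sigma\in K_n}u^{p(\sigma)}$, and let $P(t)=\sum_{n\ge0}|K_n(p)|t^n$. Then $$P(t)=\frac{(1+t)^2A(t)}{1+t+tA(t)},$$ $$E(t,u)=\sum_{i\ge0}u^{\binom{i}{2}}t^i(1+u^it)\prod_{j=0}^{i}\frac{(1+u^jt)A(u^jt)}{1+u^jt+u^jtA(u^jt)}\prod_{k=1}^{i}\frac{-1-u^kt+A(u^kt)}{(1+u^kt)A(u^kt)}.$$ The initial terms of $E(t,u)$ are $1+t+2t^4+(12+2u^4)t^5+(78+12u^5)t^6+(568+78u^6)t^7+(4674+568u^7)t^8+\cdots$.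
   Context: A permutation $\sigma=\sigma_1\cdots\sigma_n$ of $\{1,\dots,n\}$ is a king permutation if $|\sigma_{i+1}-\sigma_i|>1$ for all $1\le i\le n-1$. $K_n$ is the set of king permutations of length $n$ ($K_0$ = the empty permutation, $K_1=\{1\}$) and $A(t)=\sum_{n\ge0}|K_n|t^n$ (known to equal $\sum_{n\ge0}n!\,t^n(1-t)^n/(1+t)^n$). For a mesh pattern $p=(12,R)$ with $R\subseteq\{0,1,2\}^2$, an occurrence of $p$ in $\sigma\in S_n$ is a pair of positions $i_1<i_2$ with $\sigma_{i_1}<\sigma_{i_2}$ such that for every $(x,y)\in R$ there is no position $m$ with $i_x<m<i_{x+1}$ and $v_y<\sigma_m<v_{y+1}$, where $i_0=0$, $i_3=n+1$, $v_0=0$, $v_1=\sigma_{i_1}$, $v_2=\sigma_{i_2}$, $v_3=n+1$ (first coordinate of a box indexes positions, second values). $p(\sigma)$ is the number of occurrences of $p$ in $\sigma$; $K_n(p)$ is the set of king $n$-permutations with $p(\sigma)=0$. *)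

(* Defs.v *)
From HB Require Import structures.
From mathcomp Require Import all_boot all_order all_algebra all_fingroup.
From mathcomp Require Import boolp.

Set Implicit Arguments.
Unset Strict Implicit.
Unset Printing Implicit Defensive.
Import GRing.Theory.
Local Open Scope ring_scope.

Record fps (R : Type) := FPS { fps_coef :> nat -> R }.

Lemma fpsP (R : Type) (f g : fps R) : (forall n, f n = g n) <-> f = g.
Proof.
split=> [|-> //]; case: f g => f [g] /= fg.
by congr FPS; apply/funext.
Qed.

HB.instance Definition _ (R : Type) := gen_eqMixin (fps R).
HB.instance Definition _ (R : Type) := gen_choiceMixin (fps R).

Section FpsRing.
Variable R : comNzRingType.
Implicit Types f g h : fps R.

Definition fps_add f g : fps R := FPS (fun n => f n + g n).
Definition fps_opp f : fps R := FPS (fun n => - f n).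
Definition fpsC (c : R) : fps R := FPS (fun n => c *+ (n == 0%N)).
Definition fps_mul f g : fps R :=
  FPS (fun n => \sum_(i < n.+1) f i * g (n - i)%N).

Fact fps_addA : associative fps_add.
Proof. by move=> f g h; apply/fpsP => n /=; rewrite addrA. Qed.
Fact fps_addC : commutative fps_add.
Proof. by move=> f g; apply/fpsP => n /=; rewrite addrC. Qed.
Fact fps_add0 : left_id (fpsC 0) fps_add.
Proof. by move=> f; apply/fpsP => n /=; rewrite mul0rn add0r. Qed.
Fact fps_addN : left_inverse (fpsC 0) fps_opp fps_add.
Proof. by move=> f; apply/fpsP => n /=; rewrite mul0rn addNr. Qed.

HB.instance Definition _ :=
  GRing.isZmodule.Build (fps R) fps_addA fps_addC fps_add0 fps_addN.

Let fps_mul_poly n f g (p q : {poly R}) :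
    (forall i, (i <= n)%N -> p`_i = f i) ->
    (forall i, (i <= n)%N -> q`_i = g i) ->
  forall i, (i <= n)%N -> (p * q)`_i = fps_mul f g i.
Proof.
move=> pf qg i le_in; rewrite coefM; apply: eq_bigr => j _.
rewrite pf ?qg //; first exact: leq_trans (leq_subr _ _) le_in.
by apply: leq_trans le_in; rewrite -ltnS.
Qed.

Let trunc_coef n f i : (i <= n)%N -> (\poly_(j < n.+1) f j)`_i = f i.
Proof. by rewrite coef_poly ltnS => ->. Qed.

Fact fps_mulA : associative fps_mul.
Proof.
move=> f g h; apply/fpsP => n.
pose tr f := \poly_(j < n.+1) fps_coef f j.
have tE k i : (i <= n)%N -> (tr k)`_i = k i by exact: trunc_coef.
rewrite -(fps_mul_poly (tE f) (fps_mul_poly (tE g) (tE h))) //.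
by rewrite -(fps_mul_poly (fps_mul_poly (tE f) (tE g)) (tE h)) // mulrA.
Qed.

Fact fps_mulC : commutative fps_mul.
Proof.
move=> f g; apply/fpsP => n.
pose tr f := \poly_(j < n.+1) fps_coef f j.
have tE k i : (i <= n)%N -> (tr k)`_i = k i by exact: trunc_coef.
by rewrite -(fps_mul_poly (tE f) (tE g)) // -(fps_mul_poly (tE g) (tE f)) // mulrC.
Qed.

Fact fps_mul1 : left_id (fpsC 1) fps_mul.
Proof.
move=> f; apply/fpsP => n /=; rewrite big_ord_recl /= mul1r subn0 big1 ?addr0 //.
by move=> i _; rewrite mul0r.
Qed.

Fact fps_mulDl : left_distributive fps_mul fps_add.
Proof.
move=> f g h; apply/fpsP => n /=; rewrite -big_split /=.
by apply: eq_bigr => i _; rewrite mulrDl.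
Qed.

Fact fps_one_neq0 : fpsC 1 != 0.
Proof.
apply/eqP => /fpsP /(_ 0%N) e10.
by have /eqP : 1 = 0 :> R := e10; rewrite oner_eq0.
Qed.

HB.instance Definition _ := GRing.Zmodule_isComNzRing.Build (fps R)
  fps_mulA fps_mulC fps_mul1 fps_mulDl fps_one_neq0.

Definition fpsX : fps R := FPS (fun n => (n == 1%N)%:R).

(* f(c t) *)
Definition fps_dilate (c : R) f : fps R := FPS (fun n => c ^+ n * f n).

(* S is the sum of the series of the F i in the t-adic topology of R[[t]] *)
Definition fps_series_sum (F : nat -> fps R) (S : fps R) : Prop :=
  forall n, exists N, forall m, (N <= m)%N -> (\sum_(i < m) F i) n = S n.

Lemma fpsME f g n : (f * g) n = \sum_(i < n.+1) f i * g (n - i)%N.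
Proof. by []. Qed.

Lemma fps1E n : (1 : fps R) n = (n == 0%N)%:R.
Proof. by []. Qed.

End FpsRing.

Arguments fpsX {R}.

Section FpsUnit.
Variable R : comUnitRingType.
Implicit Types f g : fps R.

Definition fps_unit : {pred fps R} := fun f => f 0%N \is a GRing.unit.

(* The first n coefficients g_0, ..., g_(n-1) of the inverse of f, from
   f_0 g_m = [m = 0] - \sum_(i < m) f_(i+1) g_(m-1-i). *)
Fixpoint fps_inv_seq f n : seq R :=
  if n is m.+1 then
    let s := fps_inv_seq f m in
    rcons s ((f 0%N)^-1 * ((m == 0%N)%:R - \sum_(i < m) f i.+1 * s`_(m.-1 - i)))
  else [::].

Definition fps_inv f : fps R :=
  if f \in fps_unit then FPS (fun n => (fps_inv_seq f n.+1)`_n) else f.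

Let size_inv_seq f n : size (fps_inv_seq f n) = n.
Proof. by elim: n => //= n IHn; rewrite size_rcons IHn. Qed.

Let nth_inv_seq f n i : (i < n)%N ->
  (fps_inv_seq f n)`_i = (fps_inv_seq f i.+1)`_i.
Proof.
elim: n => // n IHn; rewrite ltnS leq_eqVlt => /predU1P[-> //|lt_in].
by rewrite [LHS]nth_rcons size_inv_seq lt_in IHn.
Qed.

Let inv_seq_last f n : (fps_inv_seq f n.+1)`_n = (f 0%N)^-1 *
  ((n == 0%N)%:R -
     \sum_(i < n) f i.+1 * (fps_inv_seq f (n - i.+1).+1)`_(n - i.+1)).
Proof.
rewrite [LHS]nth_rcons size_inv_seq ltnn eqxx.
congr (_ * (_ - _)); apply: eq_bigr => i _; congr (_ * _).
have -> : (n.-1 - i = n - i.+1)%N by case: n i => [[] //|n] i; rewrite subSS.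
by rewrite nth_inv_seq // ltn_subrL /=; apply: leq_ltn_trans (ltn_ord i).
Qed.

Fact fps_mulVx : {in fps_unit, left_inverse 1 fps_inv *%R}.
Proof.
move=> f Uf; rewrite mulrC; apply/fpsP => n.
rewrite fpsME fps1E /fps_inv Uf big_ord_recl subn0.
rewrite [X in _ * X + _]inv_seq_last mulVKr // -addrA [X in _ + X]addrC.
by rewrite -sumrB big1 ?addr0 // => i _; rewrite subrr.
Qed.

Fact fps_unitPl f g : g * f = 1 -> fps_unit f.
Proof.
move/fpsP/(_ 0%N); rewrite fpsME big_ord1 fps1E subn0 => gf1.
by apply/unitrPr; exists (g 0%N); rewrite mulrC.
Qed.

Fact fps_inv_out : {in [predC fps_unit], fps_inv =1 id}.
Proof. by move=> f; rewrite inE /fps_inv => /negPf ->. Qed.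

HB.instance Definition _ := GRing.ComNzRing_hasMulInverse.Build (fps R)
  fps_mulVx fps_unitPl fps_inv_out.

Lemma fps_unitE f : (f \is a GRing.unit) = (f 0%N \is a GRing.unit).
Proof. by []. Qed.

End FpsUnit.

(* Positions and values are 0-based ('I_n); this does not affect the condition
   on consecutive entries. *)
Definition king (n : nat) : {set 'S_n} :=
  [set s : 'S_n | [forall i : 'I_n, forall j : 'I_n,
     (j == i.+1 :> nat) ==> (1 < `|s j - s i|)%N]].

(* The boundaries i_0, i_1, i_2, i_3 (or v_0, v_1, v_2, v_3), 1-based. *)
Definition mesh_bound (n : nat) (a b : 'I_n) (k : nat) : nat :=
  nth 0%N [:: 0; a.+1; b.+1; n.+1]%N k.

(* No entry of s lies in the box xy, where the first coordinate indexes
   positions and the second one values. *)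
Definition empty_box (n : nat) (s : 'S_n) (i j : 'I_n) (xy : 'I_3 * 'I_3) :=
  ~~ [exists m : 'I_n,
       [&& (mesh_bound i j xy.1 < m.+1 < mesh_bound i j xy.1.+1)%N
         & (mesh_bound (s i) (s j) xy.2 < (s m).+1
              < mesh_bound (s i) (s j) xy.2.+1)%N]].

(* Occurrences of the mesh pattern (12, B). *)
Definition occ12 (B : {set 'I_3 * 'I_3}) (n : nat) (s : 'S_n) :
    {set 'I_n * 'I_n} :=
  [set ij : 'I_n * 'I_n |
    [&& (ij.1 < ij.2)%N, (s ij.1 < s ij.2)%N
      & [forall xy in B, empty_box s ij.1 ij.2 xy]]].

Definition nocc12 B n (s : 'S_n) : nat := #|occ12 B s|.

Definition king_avoid B n : {set 'S_n} := [set s in king n | nocc12 B s == 0%N].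

Definition king_gf (R : comNzRingType) : fps R := FPS (fun n => #|king n|%:R).

Definition king_avoid_gf B : fps int := FPS (fun n => #|king_avoid B n|%:R).

(* A series in t whose coefficients are polynomials in u = 'X. *)
Definition king_dist_gf B : fps {poly int} :=
  FPS (fun n => \sum_(s in king n) 'X^(nocc12 B s)).

Definition boxes : {set 'I_3 * 'I_3} :=
  [set xy : 'I_3 * 'I_3 |
    (val xy.1, val xy.2) \in [:: (0, 1); (0, 2); (1, 0); (2, 0)]%N].

(* Main.v *)
Require Import Defs.
From mathcomp Require Import all_boot all_order all_algebra all_fingroup.
From mathcomp Require Import zify ring.
Import GRing.Theory.

Set Implicit Arguments.
Unset Strict Implicit.
Unset Printing Implicit Defensive.

(* The shaded boxes are empty exactly when the first entry of the occurrence is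
   strongly fixed (everything before it is smaller and everything after it is
   larger), and then every later entry completes an occurrence; so p(s) is the
   sum, over the strongly fixed entries, of the number of entries after them.
   Cutting s at its first strongly fixed entry writes s = a (+) 1 (+) b with a
   king without strongly fixed entries and b king not starting with its minimum.
   With C and B the generating functions of such a and b this gives
   E = C + C t B(ut), and the case where a is empty gives E = B + t B(ut).
   Setting u = 1 yields C (1 + t + t A) = (1 + t) A, setting u = 0 yields
   P = (1 + t) C, and iterating B = C + (C - 1) t B(ut) yields the series. *)

(** * King permutations as sequences *)

Definition far : rel nat := fun x y => (x.+1 < y) || (y.+1 < x).

Definition strong_fixed (l : seq nat) (i : nat) : bool :=
  all (fun y => y < nth 0 l i) (take i l)
  && all (fun y => nth 0 l i < y) (drop i.+1 l).

(** By the default of [find], the value [size l] means that no entry is strongly fixed. *)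
Definition first_strong (l : seq nat) : nat :=
  find (strong_fixed l) (iota 0 (size l)).

(** Written with [sumn] over a list so that it evaluates; [strong_weightE] gives the form used in
    proofs. *)
Definition strong_weight (l : seq nat) : nat :=
  sumn [seq size l - i.+1 | i <- iota 0 (size l) & strong_fixed l i].

(* The direct sum a (+) 1 (+) b. *)
Definition dsum1 (a b : seq nat) : seq nat :=
  a ++ size a :: [seq (size a).+1 + y | y <- b].

Lemma strong_fixedP l i : i < size l ->
  reflect (forall j, j < size l ->
             (j < i -> nth 0 l j < nth 0 l i)
             /\ (i < j -> nth 0 l i < nth 0 l j))
          (strong_fixed l i).
Proof.
move=> lt_il; apply: (iffP andP) => [[/(all_nthP 0) lo /(all_nthP 0) hi] j ltj|].
  split=> [ji|ij].
    by have := lo j; rewrite size_take lt_il nth_take // => ->.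
  have := hi (j - i.+1); rewrite size_drop nth_drop subnKC //.
  by apply; lia.
move=> H; split; apply/(all_nthP 0) => j.
  rewrite size_take lt_il => ji; rewrite nth_take //.
  by apply: (proj1 (H j _)) => //; lia.
rewrite size_drop => ltj; rewrite nth_drop.
by apply: (proj2 (H _ _)); lia.
Qed.

Lemma strong_weightE l :
  strong_weight l =
  \sum_(i <- iota 0 (size l) | strong_fixed l i) (size l - i.+1).
Proof. by rewrite /strong_weight sumnE big_map big_filter. Qed.

Lemma first_strong_le l : first_strong l <= size l.
Proof. by rewrite -[leqRHS](size_iota 0); apply: find_size. Qed.

Lemma first_strong_fixed l : first_strong l < size l ->
  strong_fixed l (first_strong l).
Proof.
move=> lt_l; have /(nth_find 0) : has (strong_fixed l) (iota 0 (size l)).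
  by rewrite has_find size_iota.
by rewrite nth_iota.
Qed.

Lemma not_strong_fixed l i : first_strong l = size l -> i < size l ->
  strong_fixed l i = false.
Proof.
move=> nosf lt_il; apply: contra_eqF nosf => sf_i.
rewrite neq_ltn; apply/orP; left; rewrite -[ltnRHS](size_iota 0) -has_find.
by apply/hasP; exists i; rewrite ?mem_iota.
Qed.

Lemma perm_iota_lt l n x : perm_eq l (iota 0 n) -> x \in l -> x < n.
Proof. by move=> /perm_mem ->; rewrite mem_iota. Qed.

Lemma perm_iota_size l n : perm_eq l (iota 0 n) -> size l = n.
Proof. by move=> /perm_size ->; rewrite size_iota. Qed.

Lemma size_dsum1 a b : size (dsum1 a b) = size a + (size b).+1.
Proof. by rewrite size_cat /= size_map. Qed.

Lemma iota_split k m :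
  iota 0 (k + m.+1) = iota 0 k ++ k :: [seq k.+1 + y | y <- iota 0 m].
Proof. by rewrite iotaD add0n /= -iotaDl addn0. Qed.

Lemma perm_dsum1 a b k m : perm_eq a (iota 0 k) -> perm_eq b (iota 0 m) ->
  perm_eq (dsum1 a b) (iota 0 (k + m.+1)).
Proof.
move=> pa pb; rewrite /dsum1 (perm_iota_size pa) iota_split.
by apply: perm_cat => //; rewrite perm_cons; apply: perm_map.
Qed.

(** * Direct sums around a strongly fixed entry *)

Section DirectSum.
Variables (a b : seq nat).
Hypothesis a_lt : {in a, forall x, x < size a}.

Let nth_a i : i < size a -> nth 0 a i < size a.
Proof. by move=> lti; apply/a_lt/mem_nth. Qed.

(** All that follows [a] exceeds every entry of [a], so the extra comparisons hold. *)
Lemma strong_fixed_dsum1_l i : i < size a ->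
  strong_fixed (dsum1 a b) i = strong_fixed a i.
Proof.
move=> lti; rewrite /strong_fixed /dsum1 nth_cat lti takel_cat ?(ltnW lti) //.
congr andb; rewrite drop_cat; case: ifP => [_|/negbT].
  rewrite all_cat /= nth_a //= [X in _ && X](_ : _ = true) ?andbT //.
  by apply/allP => _ /mapP[y _ ->]; have := nth_a lti; lia.
rewrite -leqNgt => le_ai; have -> : i.+1 - size a = 0 by lia.
rewrite [drop _ a]drop_oversize //= nth_a //=.
by apply/allP => _ /mapP[y _ ->]; have := nth_a lti; lia.
Qed.

Lemma strong_fixed_dsum1_m : strong_fixed (dsum1 a b) (size a).
Proof.
rewrite /strong_fixed /dsum1 nth_cat ltnn subnn take_size_cat //=.
rewrite -cat_rcons drop_size_cat ?size_rcons //.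
apply/andP; split; first by apply/allP => x /a_lt.
by apply/allP => _ /mapP[y _ ->]; lia.
Qed.

Lemma strong_fixed_dsum1_r i : i < size b ->
  strong_fixed (dsum1 a b) ((size a).+1 + i) = strong_fixed b i.
Proof.
move=> lti; rewrite /strong_fixed /dsum1 -cat_rcons.
set c := (size a).+1; have sz_c : size (rcons a (size a)) = c.
  by rewrite size_rcons.
have ge_c j : (c + j < c) = false by apply/negbTE; rewrite -leqNgt leq_addr.
rewrite nth_cat take_cat sz_c !ge_c -[in drop _]addnS drop_cat sz_c !ge_c.
rewrite !addKn (nth_map 0) //.
rewrite /= all_cat -map_take -map_drop !all_map all_rcons ltn_addr //=.
rewrite [X in X && _ && _](_ : _ = true) /=.
  by congr andb; apply: eq_all => y /=; rewrite ltn_add2l.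
by apply/allP => x /a_lt; rewrite /c; lia.
Qed.

(** Position [size a] is strongly fixed, so the search stops there exactly when it finds nothing
    inside [a]. *)
Lemma first_strong_dsum1 :
  (first_strong (dsum1 a b) == size a) = (first_strong a == size a).
Proof.
have eq_sf : {in iota 0 (size a), strong_fixed (dsum1 a b) =1 strong_fixed a}.
  by move=> i; rewrite mem_iota => /andP[_ lti]; apply: strong_fixed_dsum1_l.
rewrite /first_strong size_dsum1 iota_split find_cat (eq_in_has eq_sf).
rewrite has_find size_iota (eq_in_find eq_sf) /= strong_fixed_dsum1_m addn0.
by case: ifP => // /negbT; rewrite -leqNgt eqxx eqn_leq => ->;
  rewrite first_strong_le.
Qed.

(** Positions of [a] contribute nothing, the middle entry has [size b] entries after it, and
    positions of [b] keep the number of entries after them. *)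
Lemma strong_weight_dsum1 : first_strong a = size a ->
  strong_weight (dsum1 a b) = size b + strong_weight b.
Proof.
move=> nosf; rewrite !strong_weightE size_dsum1 iota_split big_cat /=.
rewrite big_cons strong_fixed_dsum1_m big_map big_seq_cond big1 ?add0n.
  congr (_ + _); first by lia.
  rewrite big_seq_cond [RHS]big_seq_cond; apply: eq_big => i /=.
    rewrite mem_iota /= add0n; case: ltnP => //= lti.
    exact: strong_fixed_dsum1_r.
  by rewrite mem_iota; lia.
move=> i; rewrite mem_iota => /andP[/andP[_ lti]].
by rewrite strong_fixed_dsum1_l // not_strong_fixed.
Qed.

(** Only the two junctions need care. The middle entry and the next one are adjacent in value only
    if [b] starts with 0; the default 1 of [head] accepts an empty [b]. The junction with [a] is
    always far, since [a] cannot end with its maximum. *)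
Lemma king_dsum1 : uniq a -> first_strong a = size a ->
  sorted far (dsum1 a b)
  = sorted far a && (sorted far b && (head 1 b != 0)).
Proof.
move=> Ua nosf; rewrite /dsum1 sorted_cat_cons; congr andb; last first.
  case: b => //= y s; rewrite andbC (_ : far _ _ = (y != 0)).
    congr andb; rewrite path_map; apply: eq_path => u v.
    by rewrite /= /far; lia.
  by rewrite /far; lia.
case: (lastP a) Ua nosf a_lt => // s x Ua nosf sx_lt.
rewrite size_rcons in nosf sx_lt.
rewrite -cats1 -cats1 -catA /= !sorted_cat_cons /= !andbT size_cat /= addn1.
(* the last entry is not the maximum, otherwise it would be strongly fixed *)
suff -> : far x (size s).+1 by rewrite andbT.
have := sx_lt x; rewrite mem_rcons mem_head => /(_ isT) x_lt.
rewrite /far; apply/orP; left; rewrite ltnNge; apply/negP => x_ge.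
have x_max : x = size s by lia.
have := @not_strong_fixed (rcons s x) (size s).
rewrite size_rcons nosf => /(_ erefl (ltnSn _)) /negP; apply.
rewrite /strong_fixed nth_rcons ltnn eqxx -cats1 take_size_cat // drop_oversize.
  rewrite andbT; apply/allP => y ys.
  have := sx_lt y; rewrite mem_rcons inE ys orbT => /(_ isT).
  rewrite ltnS leq_eqVlt -x_max => /predU1P[yx|//].
  by move: Ua; rewrite rcons_uniq -yx ys.
by rewrite size_cat /= addn1.
Qed.

End DirectSum.

(** A strongly fixed entry separates the others by value just as by position, so filtering by value
    recovers the two sides of [l]; the same filters on [iota] tell which values they contain. *)
Lemma strong_fixed_split l n k : perm_eq l (iota 0 (k + n.+1)) ->
  strong_fixed l k ->
  exists a b, [/\ perm_eq a (iota 0 k), perm_eq b (iota 0 n) & l = dsum1 a b].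
Proof.
move=> pl; have sz_l := perm_iota_size pl.
have lt_kl : k < size l by rewrite sz_l; lia.
set x := nth 0 l k; set a := take k l; set c := drop k.+1 l.
rewrite /strong_fixed -/x -/a -/c => /andP[/allP lo /allP hi].
have l_eq : l = a ++ x :: c by rewrite -(drop_nth 0) // cat_take_drop.
have sz_a : size a = k by rewrite size_take lt_kl.
have x_lt : x < k + n.+1 by apply: (perm_iota_lt pl); apply: mem_nth.
(* The [minn] makes the statement hold for every [y], which the induction on the length needs. *)
have flt y : [seq z <- iota 0 (k + n.+1) | z < y] = iota 0 (minn y (k + n.+1)).
  elim: (k + n.+1) => [|m IH]; first by rewrite minn0.
  rewrite -addn1 iotaD filter_cat IH /= add0n; case: ltnP => [mlt|yle].
    by rewrite !(minn_idPr _) ?iotaD //; lia.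
  by rewrite cats0 !(minn_idPl _) //; lia.
have a_f : [seq z <- l | z < x] = a.
  rewrite l_eq filter_cat /= ltnn (_ : filter _ c = [::]) ?cats0.
    by apply/all_filterP/allP.
  by apply/eqP; rewrite -[_ == _]negbK -has_filter; apply/hasPn => z /hi; lia.
have c_f : [seq z <- l | x < z] = c.
  rewrite l_eq filter_cat /= ltnn (_ : filter _ a = [::]) /=.
    by apply/all_filterP/allP.
  by apply/eqP; rewrite -[_ == _]negbK -has_filter; apply/hasPn => z /lo; lia.
(* There are [x] values below [x] and [k] positions before it. *)
have xk : x = k.
  have := perm_size (perm_filter (fun z => z < x) pl).
  by rewrite a_f flt size_iota sz_a; lia.
have pa : perm_eq a (iota 0 k).
  by have := perm_filter (fun z => z < x) pl;
    rewrite a_f flt xk (minn_idPl _) //; lia.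
have pc : perm_eq c [seq k.+1 + y | y <- iota 0 n].
  have := perm_filter (fun z => x < z) pl.
  rewrite c_f xk iota_split filter_cat /=.
  rewrite ltnn (_ : filter _ (iota _ _) = [::]) /=; last first.
    apply/eqP; rewrite -[_ == _]negbK -has_filter; apply/hasPn => z.
    by rewrite mem_iota; lia.
  rewrite (all_filterP _) //; apply/allP => _ /mapP[y _ ->]; lia.
(* The subtraction undoes the shift because every entry of [c] exceeds [k]. *)
exists a, [seq y - k.+1 | y <- c]; split=> //.
  have -> : iota 0 n = [seq z - k.+1 | z <- [seq k.+1 + y | y <- iota 0 n]].
    by rewrite -map_comp map_id_in // => y _ /=; rewrite addKn.
  exact: perm_map.
rewrite {1}l_eq /dsum1 sz_a xk -map_comp map_id_in // => y /hi.
by rewrite xk /= => lt_ky; rewrite subnKC.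
Qed.

(** * Decomposition of kings at the first strongly fixed entry *)

Definition kings n := [seq l <- permutations (iota 0 n) | sorted far l].
(** Kings without strongly fixed entries. *)
Definition kings_free n := [seq l <- kings n | first_strong l == n].
(** The default 1 keeps the empty sequence. *)
Definition kings_not0 n := [seq l <- kings n | head 1 l != 0].

Lemma mem_kings n l : (l \in kings n) = sorted far l && perm_eq l (iota 0 n).
Proof. by rewrite mem_filter mem_permutations. Qed.

Lemma kings_uniq n : uniq (kings n).
Proof. by rewrite filter_uniq // permutations_uniq. Qed.

Lemma kings_first_strong k n :
  perm_eq [seq l <- kings (k + n.+1) | first_strong l == k]
          [seq dsum1 a b | a <- kings_free k, b <- kings_not0 n].
Proof.
apply: uniq_perm; first by rewrite filter_uniq // kings_uniq.
  apply: allpairs_uniq; try by rewrite filter_uniq // kings_uniq.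
  move=> _ _ /allpairsP[[a b] [/= ha _ ->]] /allpairsP[[a' b'] [/= ha' _ ->]].
  move: ha ha'; rewrite !mem_filter !mem_permutations /=.
  move=> /and3P[_ _ /perm_iota_size sa] /and3P[_ _ /perm_iota_size sa'].
  (* Injectivity: both left summands have length [k], so equal concatenations agree piecewise. *)
  rewrite /dsum1 => /eqP; rewrite eqseq_cat ?sa ?sa' // => /andP[/eqP -> /eqP].
  by case=> /(inj_map (@addnI _)) ->.
move=> l; rewrite mem_filter mem_kings; apply/idP/allpairsP.
  move=> /and3P[/eqP fk kl pl]; have sz_l := perm_iota_size pl.
  have lt_fl : first_strong l < size l by rewrite fk sz_l; lia.
  have := first_strong_fixed lt_fl; rewrite fk.
  move=> /(strong_fixed_split pl)[a [b [pa pb lE]]].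
  have sa := perm_iota_size pa.
  have a_lt : {in a, forall x, x < size a}.
    by move=> x; rewrite sa; apply: perm_iota_lt pa.
  have fa : first_strong a = size a.
    by apply/eqP; rewrite -(@first_strong_dsum1 a b) // -lE fk sa.
  have Ua : uniq a by rewrite (perm_uniq pa) iota_uniq.
  move: kl; rewrite lE king_dsum1 // => /and3P[ka kb hb].
  exists (a, b); rewrite /= !mem_filter !mem_permutations ka kb hb pa pb /=.
  by rewrite fa sa eqxx.
move=> [[a b] /= [ha hb ->]]; move: ha hb.
rewrite !mem_filter !mem_permutations.
move=> /and3P[/eqP fa ka pa] /and3P[hb kb pb]; have sa := perm_iota_size pa.
have a_lt : {in a, forall x, x < size a}.
  by move=> x; rewrite sa; apply: perm_iota_lt pa.
have Ua : uniq a by rewrite (perm_uniq pa) iota_uniq.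
have fsa : first_strong a = size a by rewrite fa sa.
rewrite perm_dsum1 // king_dsum1 // ka kb hb /= andbT.
by rewrite -[X in _ == X]sa first_strong_dsum1 // fsa.
Qed.

(** * Occurrences of the pattern *)

Definition seq_of_perm n (s : 'S_n) : seq nat :=
  [seq val (s i) | i <- enum 'I_n].

Lemma size_seq_of_perm n (s : 'S_n) : size (seq_of_perm s) = n.
Proof. by rewrite size_map size_enum_ord. Qed.

Lemma nth_seq_of_perm n (s : 'S_n) (i : 'I_n) : nth 0 (seq_of_perm s) i = s i.
Proof. by rewrite (nth_map i) ?size_enum_ord // nth_ord_enum. Qed.

Lemma seq_of_perm_inj n : injective (@seq_of_perm n).
Proof.
move=> s s' eq_ss'; apply/permP => i; apply: val_inj.
by rewrite /= -!nth_seq_of_perm eq_ss'.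
Qed.

Lemma perm_seq_of_perm n (s : 'S_n) : perm_eq (seq_of_perm s) (iota 0 n).
Proof.
apply: uniq_perm; rewrite ?iota_uniq //.
  by rewrite map_inj_uniq ?enum_uniq // => i j /val_inj/perm_inj.
move=> x; rewrite mem_iota /= add0n; apply/mapP/idP => [[i _ ->]|ltx] //.
  exact: ltn_ord.
exists ((s^-1)%g (Ordinal ltx)); first by rewrite mem_enum.
by rewrite permKV.
Qed.

Lemma perm_of_seq n l : perm_eq l (iota 0 n) ->
  exists s : 'S_n, l = seq_of_perm s.
Proof.
move=> pl; have sz_l := perm_iota_size pl.
have lt_l (i : 'I_n) : nth 0 l i < n.
  by apply: (perm_iota_lt pl); rewrite mem_nth // sz_l.
have f_inj : injective (fun i => Ordinal (lt_l i)).
  move=> i j [] /eqP; rewrite nth_uniq ?sz_l ?(perm_uniq pl) ?iota_uniq //.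
  by move/eqP/val_inj.
exists (perm f_inj); apply: (@eq_from_nth _ 0); rewrite ?size_seq_of_perm //.
move=> i; rewrite sz_l => lti.
by rewrite (nth_seq_of_perm _ (Ordinal lti)) permE.
Qed.

Lemma perm_enum_perm n :
  perm_eq [seq seq_of_perm s | s <- enum 'S_n] (permutations (iota 0 n)).
Proof.
apply: uniq_perm; rewrite ?permutations_uniq //.
  by rewrite map_inj_uniq ?enum_uniq //; apply: seq_of_perm_inj.
move=> l; rewrite mem_permutations; apply/mapP/idP => [[s _ ->]|].
  exact: perm_seq_of_perm.
by move=> /perm_of_seq[s ->]; exists s; rewrite // mem_enum.
Qed.

Lemma king_seq n (s : 'S_n) : (s \in king n) = sorted far (seq_of_perm s).
Proof.
rewrite inE; apply/forallP/(sortedP 0) => [H i|H i].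
  rewrite size_seq_of_perm => lti.
  have lti' : i < n by lia.
  have := forallP (H (Ordinal lti')) (Ordinal lti); rewrite /= eqxx /=.
  rewrite (nth_seq_of_perm s (Ordinal lti')) (nth_seq_of_perm s (Ordinal lti)).
  by rewrite /far; lia.
apply/forallP => j; apply/implyP => /eqP ji.
have := H i; rewrite size_seq_of_perm -ji ltn_ord => /(_ isT).
by rewrite !nth_seq_of_perm /far; lia.
Qed.

Lemma strong_fixed_seqP n (s : 'S_n) (i : 'I_n) :
  reflect (forall j : 'I_n, (j < i -> s j < s i) /\ (i < j -> s i < s j))
          (strong_fixed (seq_of_perm s) i).
Proof.
have lti : i < size (seq_of_perm s) by rewrite size_seq_of_perm.
apply: (iffP (strong_fixedP lti)) => H j.
  by have := H j; rewrite size_seq_of_perm !nth_seq_of_perm; apply.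
rewrite size_seq_of_perm => ltj.
by have := H (Ordinal ltj); rewrite -!nth_seq_of_perm.
Qed.

Lemma perm_lt_neq n (s : 'S_n) (i j : 'I_n) : i < j -> s i <> s j :> nat.
Proof. by move=> lt_ij /val_inj/perm_inj eq_ij; rewrite eq_ij ltnn in lt_ij. Qed.

(** Boxes (0,1) and (0,2) exclude larger entries before [i], boxes (1,0) and (2,0) smaller entries
    after it. The entry at [j] lies on the box boundaries, but it is later and larger anyway. *)
Lemma occ12_boxes n (s : 'S_n) (i j : 'I_n) :
  ((i, j) \in occ12 boxes s) = (i < j) && strong_fixed (seq_of_perm s) i.
Proof.
rewrite inE /=; case: ltnP => //= lt_ij; apply/andP/strong_fixed_seqP.
  move=> [lt_s /forall_inP emp] m.
  have box x y (hx : x < 3) (hy : y < 3) :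
      (x, y) \in [:: (0, 1); (0, 2); (1, 0); (2, 0)] ->
      ~~ ((mesh_bound i j x < m.+1 < mesh_bound i j x.+1)
          && (mesh_bound (s i) (s j) y < (s m).+1
                < mesh_bound (s i) (s j) y.+1)).
    move=> xyB; have := emp (Ordinal hx, Ordinal hy); rewrite inE /= xyB.
    by move=> /(_ isT); rewrite /empty_box negb_exists => /forallP/(_ m).
  have := box 0 1 isT isT isT; have := box 0 2 isT isT isT.
  have := box 1 0 isT isT isT; have := box 2 0 isT isT isT.
  rewrite /mesh_bound /=; have := ltn_ord m; have := ltn_ord (s m).
  have := @perm_lt_neq _ s i m; have := @perm_lt_neq _ s m i.
  have := @perm_lt_neq _ s j m; have := @perm_lt_neq _ s m j.
  (* The entry at [j] is in no open box; here [i < j] and [s i < s j] conclude. *)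
  have [/eqP|] := boolP (m == j :> nat).
    by move/val_inj ->; lia.
  lia.
move=> sf; split; first by case: (sf j) => _ /(_ lt_ij).
have s_ij := proj2 (sf j) lt_ij.
apply/forall_inP => -[[x hx] [y hy]]; rewrite inE /= => xyB.
rewrite /empty_box negb_exists; apply/forallP => m /=.
have := proj1 (sf m); have := proj2 (sf m).
have [/eqP/val_inj ->|] := boolP (m == i :> nat);
  by move: xyB; rewrite !inE /mesh_bound => /or4P[] /eqP[-> ->] /=; lia.
Qed.

Lemma nocc12_boxes n (s : 'S_n) :
  nocc12 boxes s = strong_weight (seq_of_perm s).
Proof.
rewrite /nocc12 -sum1_card strong_weightE size_seq_of_perm.
rewrite -[X in iota 0 X](subn0 n) -/(index_iota 0 n) big_mkord.
transitivity
  (\sum_(i < n | strong_fixed (seq_of_perm s) i) \sum_(j < n | i < j) 1).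
  rewrite pair_big_dep; apply: eq_bigl => -[i j] /=.
  by rewrite occ12_boxes andbC.
apply: eq_bigr => i _.
by rewrite -(big_geq_mkord _ _ xpredT (fun=> 1)) sum_nat_const_nat muln1.
Qed.

Local Open Scope ring_scope.

(** Passage from permutations to lists, applied below to the powers of 'X, of 0 and of 1. *)
Lemma big_king (R : comNzRingType) n (F : nat -> R) :
  \sum_(s in king n) F (nocc12 boxes s) = \sum_(l <- kings n) F (strong_weight l).
Proof.
rewrite /kings big_filter -(perm_big _ (perm_enum_perm n)) big_map /=.
rewrite big_enum_cond /=; apply: eq_big => s /=; first by rewrite king_seq.
by rewrite nocc12_boxes.
Qed.

(** * Functional equations *)

Section KingSeries.
Variable R : comNzRingType.
Implicit Types (x c : R) (f g : fps R).

Lemma fpsXME f n : (fpsX * f) n = if n is m.+1 then f m else 0.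
Proof.
rewrite fpsME; case: n => [|n]; first by rewrite big_ord1 mul0r.
rewrite !big_ord_recl /= mul0r add0r mul1r /bump /= subn1 big1 ?addr0 //.
by move=> i _; rewrite mul0r.
Qed.

Lemma fps_dilateD c f g :
  fps_dilate c (f + g) = fps_dilate c f + fps_dilate c g.
Proof. by apply/fpsP => n; rewrite /= mulrDr. Qed.

Lemma fps_dilateM c f g :
  fps_dilate c (f * g) = fps_dilate c f * fps_dilate c g.
Proof.
apply/fpsP => n; rewrite fpsME /= mulr_sumr; apply: eq_bigr => i _ /=.
by rewrite mulrACA -exprD subnKC // -ltnS.
Qed.

Lemma fps_dilate1 c : fps_dilate c 1 = 1.
Proof. by apply/fpsP => -[|n]; rewrite /= ?mulr1 // mulr0. Qed.

Lemma fps_dilateX c : fps_dilate c fpsX = fpsC c * fpsX.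
Proof.
apply/fpsP => n; rewrite mulrC fpsXME.
by case: n => [|[|n]] /=; rewrite ?mulr0 // mulr1.
Qed.

Lemma fps_dilate_dilate c d f :
  fps_dilate c (fps_dilate d f) = fps_dilate (c * d) f.
Proof. by apply/fpsP => n; rewrite /= mulrA exprMn. Qed.

Lemma fps_dilate_id f : fps_dilate 1 f = f.
Proof. by apply/fpsP => n; rewrite /= expr1n mul1r. Qed.

Lemma fpsCX c n : fpsC c ^+ n = fpsC (c ^+ n).
Proof.
elim: n => // n IH; rewrite exprS IH; apply/fpsP => m.
rewrite fpsME big_ord_recl /= subn0 big1 => [|i _]; last by rewrite mul0r.
by rewrite addr0 mulr1n; case: m => [|m] /=; rewrite ?mulr0n ?mulr0 // exprS.
Qed.

(** The variable u becomes an arbitrary ring element [x], so that the functional equations can be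
    used at 'X, 0 and 1. These three series are the E, B and C of the overview. *)
Definition kings_gf x : fps R :=
  FPS (fun n => \sum_(l <- kings n) x ^+ strong_weight l).
Definition kings_not0_gf x : fps R :=
  FPS (fun n => \sum_(l <- kings_not0 n) x ^+ strong_weight l).
Definition kings_free_gf : fps R := FPS (fun n => (size (kings_free n))%:R).

(** The weight of [dsum1 a b] is that of [b] plus [size b]; the factor [x ^+ size b] is the dilation
    of t by [x]. *)
Lemma sum_kings_first_strong x k n :
  \sum_(l <- kings (k + n.+1) | first_strong l == k) x ^+ strong_weight l
  = kings_free_gf k * fps_dilate x (kings_not0_gf x) n.
Proof.
rewrite -big_filter (perm_big _ (kings_first_strong k n)) big_allpairs_dep /=.
transitivity
  (\sum_(a <- kings_free k) fps_dilate x (kings_not0_gf x) n); last first.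
  by rewrite big_const_seq count_predT iter_addr_0 mulr_natl.
rewrite big_seq [RHS]big_seq; apply: eq_bigr => a.
rewrite !mem_filter mem_permutations => /and3P[/eqP fa ka pa].
rewrite [RHS]/= mulr_sumr big_seq [RHS]big_seq; apply: eq_bigr => b.
rewrite !mem_filter mem_permutations => /and3P[_ _ pb].
have sa := perm_iota_size pa; rewrite strong_weight_dsum1 ?fa ?sa //.
  by rewrite (perm_iota_size pb) exprD.
by move=> y; apply: perm_iota_lt pa.
Qed.

Lemma kings_gfE x :
  kings_gf x
  = kings_free_gf
    + kings_free_gf * (fpsX * fps_dilate x (kings_not0_gf x)).
Proof.
apply/fpsP => n.
rewrite [LHS]/= -[RHS]/(kings_free_gf n + (kings_free_gf * _) n) fpsME.
under [X in _ = _ + X]eq_bigr do rewrite fpsXME.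
(* The last convolution term vanishes because the factor [fpsX] leaves no constant coefficient. *)
rewrite big_ord_recr /= subnn mulr0 addr0.
(* Kings are classified by their first strongly fixed position; the class of index [n] contains
   those that have none and gives the summand [kings_free_gf]. *)
pose first l : 'I_n.+1 := inord (first_strong l).
rewrite big_seq (partition_big first xpredT) //= big_ord_recr /= addrC.
have firstE l (k : 'I_n.+1) :
    l \in kings n -> (first l == k) = (first_strong l == k).
  rewrite mem_kings => /andP[_ /perm_iota_size sz_l].
  by rewrite -val_eqE /= inordK // ltnS -[leqRHS]sz_l first_strong_le.
congr (_ + _).
  rewrite (eq_bigl (fun l => (l \in kings n) && (first_strong l == n))).
    rewrite -big_seq_cond -big_filter -/(kings_free n) -sum1_size natr_sum.
    rewrite big_seq [RHS]big_seq; apply: eq_bigr => l.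
    rewrite !mem_filter mem_permutations => /and3P[/eqP fl _ pl].
    rewrite strong_weightE big_seq_cond big1 ?expr0 // => i.
    rewrite mem_iota => /andP[/andP[_ lti]].
    by rewrite not_strong_fixed // fl (perm_iota_size pl).
  by move=> l; case: (boolP (l \in kings n)) => // /firstE ->.
apply: eq_bigr => k _; have ltk := ltn_ord k.
rewrite (eq_bigl (fun l => (l \in kings n) && (first_strong l == k))).
  have -> : (n - k = (n - k.+1).+1)%N by lia.
  rewrite -sum_kings_first_strong -big_seq_cond.
  by have -> : (k + (n - k.+1).+1 = n)%N by lia.
by move=> l; case: (boolP (l \in kings n)) => // /firstE ->.
Qed.

(** Nothing precedes position 0, so it is strongly fixed exactly when it holds the minimum. *)
Lemma head_first_strong l n : perm_eq l (iota 0 n.+1) ->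
  (head 1%N l == 0%N) = (first_strong l == 0%N).
Proof.
move=> pl; have sz_l := perm_iota_size pl.
have mem0 : 0%N \in l by rewrite (perm_mem pl) mem_iota.
have : uniq l by rewrite (perm_uniq pl) iota_uniq.
rewrite /first_strong sz_l.
case: l {pl sz_l} mem0 => // x s mem0 /= /andP[xs _].
rewrite /strong_fixed /= drop0; case: ifP => [/allP lt_x|/negbT ge_x].
  move: mem0; rewrite inE eq_sym => /predU1P[-> //|/lt_x //].
apply: contraNF ge_x => /eqP x0; apply/allP => y ys.
by rewrite x0 lt0n; apply: contraNneq xs => y0; rewrite x0 -y0.
Qed.

Lemma kings_gf_head x :
  kings_gf x = kings_not0_gf x + fpsX * fps_dilate x (kings_not0_gf x).
Proof.
apply/fpsP => n; rewrite [LHS]/= -[RHS]/(kings_not0_gf x n + (fpsX * _) n).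
rewrite fpsXME /= (bigID (fun l => head 1%N l != 0%N)) /=.
congr (_ + _); [by rewrite [RHS]big_filter | case: n => [|n]].
  by rewrite big_seq_cond big1 // => l; rewrite mem_kings => /andP[/andP[_]];
    move=> /perm_iota_size/size0nil ->.
(* Starting with 0 is the case [k = 0] of the decomposition, where [a] is empty. *)
rewrite -[RHS]mul1r -[1 in RHS](_ : kings_free_gf 0 = 1) //.
rewrite -(sum_kings_first_strong x 0 n) big_seq_cond [RHS]big_seq_cond.
apply: eq_bigl => l; rewrite mem_kings negbK; case: (sorted _ _) => //=.
by case: (boolP (perm_eq _ _)) => //= /head_first_strong ->.
Qed.

Lemma kings_gf1 : kings_gf 1 = king_gf R.
Proof.
apply/fpsP => n; rewrite /= -(big_king n (fun i => 1 ^+ i)) -sumr_const.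
by apply: eq_bigr => s _; rewrite expr1n.
Qed.

(** At [x = 1] the dilation is trivial, and [B] is eliminated between A = C + C t B and A = (1 + t)
    B. *)
Lemma kings_free_gfE :
  kings_free_gf * (1 + fpsX + fpsX * king_gf R) = (1 + fpsX) * king_gf R.
Proof.
have := kings_gfE 1; have := kings_gf_head 1.
rewrite kings_gf1 fps_dilate_id; set B := kings_not0_gf 1 => eqB eqC.
by rewrite [in RHS]eqC eqB; ring.
Qed.

Lemma fpsXnM_lt m n f : (n < m)%N -> (fpsX ^+ m * f) n = 0.
Proof.
elim: m n => // m IH n; rewrite exprS -mulrA fpsXME.
by case: n => // n; rewrite ltnS => /IH.
Qed.

End KingSeries.

Lemma fps_divr_eq (R : comUnitRingType) (f g h : fps R) :
  h 0%N = 1 -> f * h = g -> g / h = f.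
Proof. by move=> h0 <-; rewrite mulrK // fps_unitE h0 unitr1. Qed.

Lemma king_gf0 (R : comNzRingType) : king_gf R 0%N = 1.
Proof. by rewrite -kings_gf1 /= big_seq1. Qed.

Lemma king_dist_gfE : king_dist_gf boxes = kings_gf 'X.
Proof. by apply/fpsP => n; rewrite /= -(big_king n (fun i => 'X^i)). Qed.

(* Avoidance is the specialisation u = 0, since 0 ^ 0 = 1. *)
Lemma king_avoid_gfE : king_avoid_gf boxes = (1 + fpsX) * kings_free_gf int.
Proof.
transitivity (kings_gf (0 : int)).
  apply/fpsP => n; rewrite /= -(big_king n (fun i => 0 ^+ i)) -sumr_const.
  rewrite big_mkcond [RHS]big_mkcond; apply: eq_bigr => s _.
  by rewrite inE; case: (s \in king n) => //=; rewrite expr0n; case: eqP.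
have dil0 : fps_dilate 0 (kings_not0_gf (0 : int)) = 1.
  by apply/fpsP => -[|n]; rewrite /= ?exprS ?mul0r // mul1r big_seq1.
by rewrite kings_gfE dil0; ring.
Qed.

(** * Iteration of the functional equation *)

Section Distribution.
Let R : comUnitRingType := {poly int}.
Let t : fps R := fpsX.
Let u : fps R := fpsC 'X.
Let A k : fps R := fps_dilate 'X^k (king_gf R).
Let B k : fps R := fps_dilate 'X^k (kings_not0_gf ('X : R)).
Let C k : fps R := fps_dilate 'X^k (kings_free_gf R).
Let num k : fps R := (1 + u ^+ k * t) * A k.
Let den k : fps R := 1 + u ^+ k * t + u ^+ k * t * A k.
Let q k : fps R := (- 1 - u ^+ k * t + A k) / num k.
(** The summand without its factor [1 + u ^+ i * t]; this part also multiplies the remainder of the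
    iteration. *)
Let G i : fps R := u ^+ 'C(i, 2) * t ^+ i
  * (\prod_(0 <= j < i.+1) (num j / den j)) * (\prod_(1 <= k < i.+1) q k).

Let dilate_t k : fps_dilate 'X^k t = u ^+ k * t.
Proof. by rewrite fps_dilateX -fpsCX. Qed.

Let C_den k : C k * den k = num k.
Proof.
have /(congr1 (fps_dilate 'X^k)) := kings_free_gfE R.
by rewrite !(fps_dilateM, fps_dilateD) fps_dilate1 dilate_t.
Qed.

Let ut0 k : (u ^+ k * t) 0%N = 0.
Proof. by rewrite mulrC fpsXME. Qed.

Let A0 k : A k 0%N = 1.
Proof. by rewrite /= -[X in _ * X]/(king_gf R 0%N) king_gf0 mulr1. Qed.

Let fpsM0 (f g : fps R) : (f * g) 0%N = f 0%N * g 0%N.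
Proof. by rewrite fpsME big_ord1. Qed.

Let den0 k : den k 0%N = 1.
Proof.
rewrite -[LHS]/(1 + (u ^+ k * t) 0%N + (u ^+ k * t * A k) 0%N).
by rewrite ut0 fpsM0 ut0 mul0r !addr0.
Qed.

Let num0 k : num k 0%N = 1.
Proof.
rewrite fpsM0 A0 mulr1 -[LHS]/(1 + (u ^+ k * t) 0%N).
by rewrite ut0 addr0.
Qed.

Let quo_C k : num k / den k = C k.
Proof. exact: fps_divr_eq (den0 k) (C_den k). Qed.

(** The numerator of [q k] is [num k - den k], and [C k * den k = num k]. *)
Let C_q k : C k * q k = C k - 1.
Proof.
rewrite mulrA; apply: fps_divr_eq (num0 k) _.
by rewrite mulrBl mul1r -{2}C_den /num /den; ring.
Qed.

(** The two expressions for E are equated, dilated by ['X^k] and solved for [B k]. *)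
Let B_rec k : B k = C k + (C k - 1) * (u ^+ k * t * B k.+1).
Proof.
have := kings_gfE ('X : R); rewrite kings_gf_head.
move=> /(congr1 (fps_dilate 'X^k)).
rewrite !(fps_dilateM, fps_dilateD) dilate_t fps_dilate_dilate -exprSr.
rewrite -/(B k) -/(B k.+1) -/(C k) => eqB.
by apply: (addIr (u ^+ k * t * B k.+1)); rewrite eqB; ring.
Qed.

Let G_rec i : G i.+1 = G i * (u ^+ i * t) * (C i.+1 - 1).
Proof.
rewrite /G big_nat_recr //= [X in _ * X]big_nat_recr //= quo_C -C_q.
by rewrite binS bin1 exprD exprSr; ring.
Qed.

(** Exact expansion with remainder: [B_rec] applied to the remainder splits off the summand of index
    [m] and, by [G_rec], leaves the remainder of index [m.+1]. *)
Let partial_sum m :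
  kings_gf ('X : R)
  = \sum_(i < m) G i * (1 + u ^+ i * t) + G m * (1 + u ^+ m * t * B m.+1).
Proof.
elim: m => [|m IH].
  rewrite big_ord0 add0r /G big_nat1 big_geq // quo_C kings_gfE.
  by rewrite bin0n /C /B !expr0 expr1 fps_dilate_id -/t; ring.
by rewrite IH big_ord_recr /= G_rec [B m.+1]B_rec; ring.
Qed.

Lemma king_dist_series :
  fps_series_sum
    (fun i : nat =>
       u ^+ 'C(i, 2) * t ^+ i * (1 + u ^+ i * t)
       * (\prod_(0 <= j < i.+1) (num j / den j))
       * (\prod_(1 <= k < i.+1) q k))
    (king_dist_gf boxes).
Proof.
move=> n; exists n.+1 => m lt_nm; rewrite king_dist_gfE (partial_sum m).
have -> (f g : fps R) : (f + g) n = f n + g n by [].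
(* The remainder is divisible by [t ^+ m], so it does not reach coefficient [n < m]. *)
have -> : G m * (1 + u ^+ m * t * B m.+1)
          = t ^+ m * (u ^+ 'C(m, 2) * (\prod_(0 <= j < m.+1) (num j / den j))
              * (\prod_(1 <= k < m.+1) q k) * (1 + u ^+ m * t * B m.+1)).
  by rewrite /G; ring.
rewrite fpsXnM_lt // addr0; congr (fps_coef _ n); apply: eq_bigr => i _.
by rewrite /G; ring.
Qed.

End Distribution.

(** * Initial terms by enumeration *)

(** A closed boolean test, decided by evaluation; [m != 0] keeps the two counts disjoint. *)
Definition two_weights n m c0 cm : bool :=
  let w := [seq strong_weight l | l <- kings n] in
  [&& all (mem [:: 0; m]) w, m != 0, count_mem 0 w == c0 & count_mem m w == cm]%N.

Lemma king_dist_gf_coef n m c0 cm : two_weights n m c0 cm ->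
  king_dist_gf boxes n = c0%:R + cm%:R * 'X^m.
Proof.
rewrite king_dist_gfE /= -(big_map strong_weight xpredT (fun i => 'X^i)).
case/and4P=> + m_neq0 /eqP<- /eqP<-.
elim: map => [|i w IH] /=; first by rewrite big_nil mul0r addr0.
move=> /andP[wi /IH eq_w]; rewrite big_cons eq_w !natrD.
move: wi; rewrite !inE => /orP[] /eqP ->; rewrite eqxx.
  by rewrite [_ == m]eq_sym (negPf m_neq0) /=; ring.
by rewrite (negPf m_neq0) /=; ring.
Qed.

Lemma king_dist_gf_initial :
  [seq king_dist_gf boxes n | n <- iota 0 9] =
    [:: 1; 1; 0; 0; 2; 12 + 2 * 'X^4; 78 + 12 * 'X^5; 568 + 78 * 'X^6;
        4674 + 568 * 'X^7].
Proof.
(* With the series generalised, [/=] expands only the list. *)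
move: (king_dist_gf boxes) king_dist_gf_coef => E E_coef.
rewrite [LHS]/=; congr [:: _; _; _; _; _; _; _; _; _].
(* For lengths below 5 all weights are 0; the second weight 1 is a dummy with count 0. *)
- by rewrite (E_coef 0 1 1 0) ?mul0r ?addr0 //; vm_compute.
- by rewrite (E_coef 1 1 1 0) ?mul0r ?addr0 //; vm_compute.
- by rewrite (E_coef 2 1 0 0) ?mul0r ?addr0 //; vm_compute.
- by rewrite (E_coef 3 1 0 0) ?mul0r ?addr0 //; vm_compute.
- by rewrite (E_coef 4 1 2 0) ?mul0r ?addr0 //; vm_compute.
- by apply: E_coef; vm_compute.
- by apply: E_coef; vm_compute.
- by apply: E_coef; vm_compute.
by apply: E_coef; vm_compute.
Qed.

Theorem theorem4p1 :
  let P : fps int := king_avoid_gf boxes in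
  let E : fps {poly int} := king_dist_gf boxes in
  [/\ (let t : fps int := fpsX in
       let A : fps int := king_gf int in
       P = (1 + t) ^+ 2 * A / (1 + t + t * A)),
      (let t : fps {poly int} := fpsX in
       let u : fps {poly int} := fpsC 'X in
       (* A k is A(u^k t) *)
       let A (k : nat) : fps {poly int} :=
         fps_dilate 'X^k (king_gf {poly int}) in
       fps_series_sum
         (fun i : nat =>
            u ^+ 'C(i, 2) * t ^+ i * (1 + u ^+ i * t)
            * (\prod_(0 <= j < i.+1)
                 ((1 + u ^+ j * t) * A j
                  / (1 + u ^+ j * t + u ^+ j * t * A j)))
            * (\prod_(1 <= k < i.+1)
                 ((- 1 - u ^+ k * t + A k) / ((1 + u ^+ k * t) * A k))))
         E)
    & [seq E n | n <- iota 0 9] =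
        [:: 1; 1; 0; 0; 2; 12 + 2 * 'X^4; 78 + 12 * 'X^5; 568 + 78 * 'X^6;
            4674 + 568 * 'X^7]].
Proof.
move=> P E; split=> [t A | |].
- rewrite /P king_avoid_gfE; apply/esym/fps_divr_eq.
    (* The denominator has constant term 1, hence is invertible. *)
    by rewrite /= -[LHS]/(1 + 0 + (fpsX * A) 0%N) fpsXME !addr0.
  by rewrite -mulrA kings_free_gfE mulrA -expr2.
- exact: king_dist_series.
exact: king_dist_gf_initial.
Qed.
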